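(* Let $M\geq 2$ be an integer and $\rho>0$ a real number. Consider all pairs $(X,Y)$ where $X$ is a random variable with values in $\{1,\ldots,M\}$ and $Y$ is an arbitrary random variable (side information). The optimal lower bound of the conditional $\rho$-guessing entropy $G_\rho(X|Y)$ in terms of the conditional Shannon entropy $H(X|Y)$ is given by the parametric curve, $\gamma\in(0,1]$, $$G_\rho(\gamma)=\frac{\sum_{i=1}^M i^\rho\gamma^{i^\rho}}{\sum_{i=1}^M\gamma^{i^\rho}},\qquad H(\gamma)=\log\Bigl(\sum_{i=1}^M\gamma^{i^\rho}\Bigr)-(\log\gamma)\,\frac{\sum_{i=1}^M i^\rho\gamma^{i^\rho}}{\sum_{i=1}^M\gamma^{i^\rho}}.$$ That is: (i) for every $(X,Y)$ and every $\gamma\in(0,1]$ with $H(X|Y)=H(\gamma)$, one has $G_\rho(X|Y)\geq G_\rho(\gamma)$; (ii) for every $\gamma\in(0,1]$ there is a pair $(X,Y)$ with $H(X|Y)=H(\gamma)$ and $G_\rho(X|Y)=G_\rho(\gamma)$; (iii) every value in $(0,\log M]$ is of the form $H(\gamma)$ for some $\gamma\in(0,1]$.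
   Context: $\log$ is the logarithm to an arbitrary fixed base greater than $1$. For a random variable $X$ with values in $\{1,\ldots,M\}$ and pmf $p_X$: the Shannon entropy is $H(X)=-\sum_{i} p_X(i)\log p_X(i)$ (with $0\log 0=0$), and the $\rho$-guessing entropy is $G_\rho(X)=\min_\sigma\sum_{i=1}^M p_X(\sigma(i))\,i^\rho$, the minimum being over all permutations $\sigma$ of $\{1,\ldots,M\}$. For an arbitrary (discrete or continuous) random variable $Y$, with $H(X|Y=y)$ and $G_\rho(X|Y=y)$ denoting these quantities computed for the conditional pmf $p_{X|Y=y}$, set $H(X|Y)=\mathbb{E}_y H(X|Y=y)$ and $G_\rho(X|Y)=\mathbb{E}_y G_\rho(X|Y=y)$, where the expectation is over the distribution of $Y$. *)

(* Defs.v *)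
From HB Require Import structures.
From mathcomp Require Export all_boot all_order all_algebra all_fingroup.
From mathcomp Require Export all_classical all_reals all_analysis.
Export Order.TTheory GRing.Theory Num.Theory numFieldNormedType.Exports.

Set Implicit Arguments.
Unset Strict Implicit.
Unset Printing Implicit Defensive.

Local Open Scope classical_set_scope.
Local Open Scope charge_scope.
Local Open Scope ring_scope.

(* Since ln 0 = 0 in the library, x * logb b x vanishes at x = 0. *)
Definition logb {R : realType} (b x : R) : R := ln x / ln b.

(* A pmf on {1, ..., M} is p : 'I_M -> R, where p i is the mass of i.+1. *)

Definition entropy {R : realType} (b : R) {M : nat} (p : 'I_M -> R) : R :=
  - \sum_(i < M) p i * logb b (p i).

Definition guess_cost {R : realType} (rho : R) {M : nat} (p : 'I_M -> R)
    (s : 'S_M) : R :=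
  \sum_(i < M) p (s i) * (i.+1%:R `^ rho).

(* The default value is the cost of the identity, which belongs to the range,
   so this is the minimum of guess_cost over all permutations. *)
Definition guessing_entropy {R : realType} (rho : R) {M : nat}
    (p : 'I_M -> R) : R :=
  \big[Num.min/guess_cost rho p 1%g]_(s : 'S_M) guess_cost rho p s.

Definition joint_law {d d'} {Omega : measurableType d} {T : measurableType d'}
    {R : realType} (P : probability Omega R)
    (X : {RV P >-> nat}) (Y : {RV P >-> T}) (k : nat) : set T -> \bar R :=
  fun B => P (X @^-1` [set k] `&` Y @^-1` B).

Section joint_law_charge.
Context {d d'} {Omega : measurableType d} {T : measurableType d'}
  {R : realType} {P : probability Omega R}
  (X : {RV P >-> nat}) (Y : {RV P >-> T}) (k : nat).

Lemma measurable_fiber : measurable (X @^-1` [set k]).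
Proof. by rewrite -[X in measurable X]setTI; exact: measurable_funP. Qed.

Lemma measurable_rv_preimage (B : set T) :
  measurable B -> measurable (Y @^-1` B).
Proof.
by move=> mB; rewrite -[X in measurable X]setTI; exact: measurable_funP.
Qed.

Let joint_law0 : joint_law X Y k set0 = 0%E.
Proof. by rewrite /joint_law preimage_set0 setI0 measure0. Qed.

Let joint_law_fin (B : set T) :
  measurable B -> joint_law X Y k B \is a fin_num.
Proof.
move=> mB; apply: fin_num_measure; apply: measurableI.
  exact: measurable_fiber.
exact: measurable_rv_preimage.
Qed.

Let joint_law_sigma_additive : semi_sigma_additive (joint_law X Y k).
Proof.
move=> F mF tF mUF; rewrite /joint_law preimage_bigcup setI_bigcupr.
apply: measure_semi_sigma_additive.
- move=> n; apply: measurableI; first exact: measurable_fiber.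
  exact: measurable_rv_preimage.
- apply/trivIsetP => i j _ _ ij.
  move/trivIsetP : tF => /(_ i j Logic.I Logic.I ij) Fij0.
  by rewrite setIACA setIid -preimage_setI Fij0 preimage_set0 setI0.
- rewrite -setI_bigcupr -preimage_bigcup; apply: measurableI.
    exact: measurable_fiber.
  exact: measurable_rv_preimage.
Qed.

HB.instance Definition _ := isCharge.Build _ _ _ (joint_law X Y k)
  joint_law0 joint_law_fin joint_law_sigma_additive.

Lemma joint_law_dominates : joint_law X Y k `<< distribution P Y.
Proof.
apply/null_content_dominatesP => B mB YB0.
apply/eqP; rewrite eq_le measure_ge0 andbT.
rewrite -YB0 /distribution /pushforward /joint_law.
apply: le_measure; rewrite ?inE.
- by apply: measurableI; [exact: measurable_fiber|exact: measurable_rv_preimage].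
- exact: measurable_rv_preimage.
- exact: subIsetr.
Qed.

End joint_law_charge.

(* The conditional probability P(X = i.+1 | Y = y), as the Radon-Nikodym
   derivative at y of B |-> P(X = i.+1, Y \in B) with respect to the law of Y.
   As usual it is determined (and is a pmf) for almost every y only, which is
   all that the expectations over Y below depend on. *)
Definition cond_pmf {d d'} {Omega : measurableType d} {T : measurableType d'}
    {R : realType} (P : probability Omega R)
    (X : {RV P >-> nat}) (Y : {RV P >-> T}) (M : nat) (y : T) : 'I_M -> R :=
  fun i => fine (('d (joint_law X Y i.+1) '/d (distribution P Y)) y).

Section cond_pmf_lemmas.
Context {d d'} {Omega : measurableType d} {T : measurableType d'}
  {R : realType} {P : probability Omega R}
  (X : {RV P >-> nat}) (Y : {RV P >-> T}) (M : nat).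

Lemma cond_pmfE (y : T) (i : 'I_M) :
  (cond_pmf X Y y i)%:E = ('d (joint_law X Y i.+1) '/d (distribution P Y)) y.
Proof.
rewrite /cond_pmf fineK//; apply: Radon_Nikodym_fin_num.
exact: joint_law_dominates.
Qed.

Lemma cond_pmf_integrable (i : 'I_M) :
  (distribution P Y).-integrable setT (fun y => (cond_pmf X Y y i)%:E).
Proof.
under eq_fun do rewrite cond_pmfE.
apply: Radon_Nikodym_integrable; exact: joint_law_dominates.
Qed.

Lemma integral_cond_pmf (i : 'I_M) (B : set T) : measurable B ->
  (\int[distribution P Y]_(y in B) (cond_pmf X Y y i)%:E =
    P (X @^-1` [set i.+1] `&` Y @^-1` B))%E.
Proof.
move=> mB; under eq_integral do rewrite cond_pmfE.
by rewrite -Radon_Nikodym_integral//; exact: joint_law_dominates.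
Qed.

End cond_pmf_lemmas.

Definition cond_entropy {d d'} {Omega : measurableType d}
    {T : measurableType d'} {R : realType} (b : R) (M : nat)
    (P : probability Omega R) (X : {RV P >-> nat}) (Y : {RV P >-> T}) : \bar R :=
  \int[distribution P Y]_y (entropy b (@cond_pmf _ _ _ _ _ P X Y M y))%:E.

Definition cond_guessing_entropy {d d'} {Omega : measurableType d}
    {T : measurableType d'} {R : realType} (rho : R) (M : nat)
    (P : probability Omega R) (X : {RV P >-> nat}) (Y : {RV P >-> T}) : \bar R :=
  \int[distribution P Y]_y
    (guessing_entropy rho (@cond_pmf _ _ _ _ _ P X Y M y))%:E.

Definition curve_G {R : realType} (rho : R) (M : nat) (gamma : R) : R :=
  (\sum_(1 <= i < M.+1) (i%:R `^ rho) * (gamma `^ (i%:R `^ rho)))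
    / (\sum_(1 <= i < M.+1) gamma `^ (i%:R `^ rho)).

Definition curve_H {R : realType} (b rho : R) (M : nat) (gamma : R) : R :=
  logb b (\sum_(1 <= i < M.+1) gamma `^ (i%:R `^ rho))
  - logb b gamma * curve_G rho M gamma.

(* Main.v *)
From HB Require Import structures.
Require Import Defs.
From mathcomp Require Import measurable_realfun ring lra.

(* Let q be the pmf proportional to gamma `^ (i `^ rho) and S its normalizing
   constant. Since log q is affine in i `^ rho, Gibbs' inequality against q
   reads H(p) <= log S - (log gamma) G(p) for every pmf p, with equality at
   p = q. This affine bound survives the expectation over Y, which gives the
   lower bound for gamma < 1, and the case gamma = 1 follows by continuity.
   Attainment takes X of law q and Y constant, and surjectivity of H(gamma) is
   the intermediate value theorem between H(0+) = 0 and H(1) = log M. *)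

Set Implicit Arguments.
Unset Strict Implicit.
Unset Printing Implicit Defensive.

Local Open Scope classical_set_scope.
Local Open Scope ring_scope.

(** * Gibbs' inequality and the pmfs on the curve *)

Section pmf.
Context {R : realType} {M : nat}.
Implicit Types (p q : 'I_M -> R) (b rho gamma : R).

Definition is_pmf p := (forall i, 0 <= p i) /\ \sum_(i < M) p i = 1.

Lemma is_pmf_perm p (s : 'S_M) : is_pmf p -> is_pmf (p \o s).
Proof.
move=> [p0 p1]; split=> [i|]; first exact: p0.
by rewrite -p1 [RHS](reindex_inj (@perm_inj _ s)).
Qed.

Lemma is_pmf_le1 p i : is_pmf p -> p i <= 1.
Proof.
move=> [p0 <-]; rewrite (bigD1 i)//= lerDl; apply: sumr_ge0 => j _; exact: p0.
Qed.

Lemma entropy_perm b p (s : 'S_M) : entropy b (p \o s) = entropy b p.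
Proof. by rewrite /entropy [in RHS](reindex_inj (@perm_inj _ s)). Qed.

(** The inequality ln (1 + t) <= t at t = q/p - 1 gives p (ln p - ln q) >= p - q termwise, and the
    right-hand sides sum to 0. Indices with p = 0 are treated apart. *)
Lemma gibbs b p q : 1 < b -> is_pmf p -> (forall i, 0 < q i) ->
  \sum_(i < M) q i = 1 -> entropy b p <= - \sum_(i < M) p i * logb b (q i).
Proof.
move=> b1 [p0 p1] q0 q1; rewrite /entropy lerN2 -subr_ge0 -sumrB.
have lnb : 0 < ln b by rewrite ln_gt0.
have -> : \sum_(i < M) (p i * logb b (p i) - p i * logb b (q i)) =
    (\sum_(i < M) p i * (ln (p i) - ln (q i))) / ln b.
  by rewrite mulr_suml; apply: eq_bigr => i _; rewrite /logb -mulrBr -mulrBl mulrA.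
apply: divr_ge0; last exact: ltW.
apply: (@le_trans _ _ (\sum_(i < M) (p i - q i))).
  by rewrite sumrB p1 q1 subrr.
apply: ler_sum => i _; have := p0 i; rewrite le_eqVlt => /predU1P[<-|pi0].
  by rewrite mul0r sub0r oppr_le0 ltW.
have -> : ln (p i) - ln (q i) = - ln (1 + (q i / p i - 1)).
  by rewrite [1 + _]addrC subrK ln_div ?posrE// opprB.
rewrite mulrN lerNr opprB.
have -> : q i - p i = p i * (q i / p i - 1).
  by rewrite mulrBr mulr1 mulrC divfK// gt_eqF.
rewrite ler_pM2l// le_ln1Dx// ltrBrDl subrr divr_gt0//.
Qed.

Definition weight rho (i : nat) : R := i.+1%:R `^ rho.

Definition partition rho gamma : R := \sum_(i < M) gamma `^ weight rho i.

(** For positive [gamma] this is the Boltzmann distribution with energy levels [weight rho i] and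
    inverse temperature - ln [gamma]; it is uniform at [gamma] = 1. *)
Definition curve_pmf rho gamma (i : 'I_M) : R :=
  gamma `^ weight rho i / partition rho gamma.

Lemma curve_GE rho gamma : curve_G rho M gamma =
  guess_cost rho (curve_pmf rho gamma) 1%g.
Proof.
rewrite /curve_G !big_add1 !big_mkord mulr_suml /guess_cost.
by apply: eq_bigr => i _; rewrite perm1 -mulrA mulrC.
Qed.

Lemma curve_HE b rho gamma : curve_H b rho M gamma =
  logb b (partition rho gamma) - logb b gamma * curve_G rho M gamma.
Proof. by rewrite /curve_H big_add1 big_mkord. Qed.

Hypothesis M0 : (0 < M)%N.

Lemma partition_gt0 rho gamma : 0 < gamma -> 0 < partition rho gamma.
Proof.
move=> g0; rewrite /partition (bigD1 (Ordinal M0))//= ltr_pwDl ?powR_gt0//.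
by apply: sumr_ge0 => i _; exact: powR_ge0.
Qed.

Lemma curve_pmf_gt0 rho gamma i : 0 < gamma -> 0 < curve_pmf rho gamma i.
Proof. by move=> g0; rewrite divr_gt0 ?powR_gt0 ?partition_gt0. Qed.

Lemma curve_pmf_pmf rho gamma : 0 < gamma -> is_pmf (curve_pmf rho gamma).
Proof.
move=> g0; split=> [i|]; first exact/ltW/curve_pmf_gt0.
by rewrite -mulr_suml divff// gt_eqF// partition_gt0.
Qed.

(* The cross entropy of p \o s relative to the curve pmf is affine in the
   guessing cost, because the log of that pmf is affine in the weight. *)
Lemma cross_entropy_curve b rho gamma p (s : 'S_M) : 0 < gamma -> is_pmf p ->
  - \sum_(i < M) p (s i) * logb b (curve_pmf rho gamma i) =
  logb b (partition rho gamma) - logb b gamma * guess_cost rho p s.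
Proof.
move=> g0 /(is_pmf_perm s)[_ p1].
rewrite /guess_cost mulr_sumr -[X in X - _]mul1r -[in X in X - _]p1 mulr_suml.
rewrite -sumrN -sumrB; apply: eq_bigr => i _ /=.
rewrite /curve_pmf /logb ln_div ?posrE ?powR_gt0 ?partition_gt0// ln_powR /weight.
ring.
Qed.

Lemma entropy_le_guess_cost b rho gamma p (s : 'S_M) :
    1 < b -> 0 < gamma -> is_pmf p ->
  entropy b p <= logb b (partition rho gamma) - logb b gamma * guess_cost rho p s.
Proof.
move=> b1 g0 pp; rewrite -(entropy_perm b p s) -cross_entropy_curve//.
apply: gibbs => // [|i|]; [exact: is_pmf_perm|exact: curve_pmf_gt0|].
exact: (curve_pmf_pmf rho g0).2.
Qed.

Lemma guessing_entropy_le rho p (s : 'S_M) :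
  guessing_entropy rho p <= guess_cost rho p s.
Proof. exact: bigmin_le. Qed.

Lemma guessing_entropy_attained rho p :
  exists s : 'S_M, guessing_entropy rho p = guess_cost rho p s.
Proof.
rewrite /guessing_entropy; elim/big_ind: _ => [|x y [s ->] [t ->]|s _].
- by exists 1%g.
- by rewrite /Order.min; case: ifP => _; [exists s|exists t].
- by exists s.
Qed.

Lemma entropy_le_guessing b rho gamma p : 1 < b -> 0 < gamma -> is_pmf p ->
  entropy b p <=
  logb b (partition rho gamma) - logb b gamma * guessing_entropy rho p.
Proof.
move=> b1 g0 pp; have [s ->] := guessing_entropy_attained rho p.
exact: entropy_le_guess_cost.
Qed.

Lemma entropy_curve_pmf b rho gamma : 0 < gamma ->
  entropy b (curve_pmf rho gamma) = curve_H b rho M gamma.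
Proof.
move=> g0; rewrite curve_HE curve_GE.
rewrite -(cross_entropy_curve b rho 1%g g0 (curve_pmf_pmf rho g0)).
by congr (- _); apply: eq_bigr => i _; rewrite perm1.
Qed.

Lemma logb1 b : logb b 1 = 0.
Proof. by rewrite /logb ln1 mul0r. Qed.

Lemma logb_lt0 b gamma : 1 < b -> 0 < gamma < 1 -> logb b gamma < 0.
Proof. by move=> b1 g01; rewrite /logb pmulr_llt0 ?ln_lt0// invr_gt0 ln_gt0. Qed.

(** The identity is an optimal order, and no rearrangement argument is needed: for [gamma] < 1 the
    affine bound is an equality at the identity, so comparing it with the bound at any [s] and
    cancelling - log [gamma] > 0 orders the costs. *)
Lemma guessing_curve_pmf rho gamma : 0 < gamma <= 1 ->
  guessing_entropy rho (curve_pmf rho gamma) = curve_G rho M gamma.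
Proof.
move=> /andP[g0]; rewrite curve_GE le_eqVlt => /predU1P[g1|g1]; last first.
  apply/eqP; rewrite eq_le guessing_entropy_le/=.
  have [s ->] := guessing_entropy_attained rho (curve_pmf rho gamma).
  (* The statement involves no base; any base above 1 would do. *)
  have b1 : 1 < 2 :> R by rewrite ltr1n.
  have := entropy_le_guess_cost rho s b1 g0 (curve_pmf_pmf rho g0).
  rewrite (entropy_curve_pmf _ _ g0).
  rewrite curve_HE.
  rewrite curve_GE.
  rewrite lerD2l lerN2.
  by rewrite ler_nM2l// logb_lt0// g0.
have [s ->] := guessing_entropy_attained rho (curve_pmf rho gamma).
(* The uniform pmf has the same cost under every permutation. *)
by apply: eq_bigr => i _; rewrite g1 /curve_pmf !powR1.
Qed.

Lemma entropy_ge0 b p : 1 < b -> is_pmf p -> 0 <= entropy b p.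
Proof.
move=> b1 pp; rewrite /entropy -sumrN sumr_ge0// => i _.
rewrite -mulrN mulr_ge0 ?pp.1// /logb -mulNr divr_ge0//.
  by rewrite oppr_ge0 ln_le0// is_pmf_le1.
exact/ln_ge0/ltW.
Qed.

Lemma guessing_entropy_ge0 rho p : is_pmf p -> 0 <= guessing_entropy rho p.
Proof.
move=> [p0 _]; have [s ->] := guessing_entropy_attained rho p.
by apply: sumr_ge0 => i _; rewrite mulr_ge0 ?powR_ge0.
Qed.

Lemma guessing_entropy_bound rho p : is_pmf p ->
  guessing_entropy rho p <= \sum_(i < M) weight rho i.
Proof.
move=> pp; apply: (le_trans (guessing_entropy_le rho p 1%g)).
apply: ler_sum => i _; rewrite ler_piMl ?powR_ge0//; exact: is_pmf_le1.
Qed.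

(** At parameter 1 the term in log [gamma] vanishes, so the affine bound reduces to the maximality
    of the uniform entropy. *)
Lemma curve_H_le_entropy1 b rho gamma : 1 < b -> 0 < gamma ->
  curve_H b rho M gamma <= curve_H b rho M 1.
Proof.
move=> b1 g0; rewrite -entropy_curve_pmf//.
have := entropy_le_guess_cost rho 1%g b1 ltr01 (curve_pmf_pmf rho g0).
by rewrite curve_HE !logb1 !mul0r.
Qed.

Lemma curve_H1 b rho : curve_H b rho M 1 = logb b M%:R.
Proof.
rewrite curve_HE logb1 mul0r subr0; congr logb.
by rewrite /partition powR1 sumr_const card_ord.
Qed.

End pmf.

(** * Integrals under almost-everywhere hypotheses *)

Section ae_integral.
Local Open Scope ereal_scope.
Context d (T : measurableType d) (R : realType).
Variable mu : {measure set T -> \bar R}.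
Implicit Types f g : T -> \bar R.

Lemma ae_integral_ge0 f : measurable_fun setT f ->
  {ae mu, forall x, 0 <= f x} -> 0 <= \int[mu]_x f x.
Proof.
move=> mf f0; rewrite (ae_eq_integral (fun x => `|f x|))//.
- exact: integral_ge0.
- exact: measurableT_comp.
- by apply: filterS f0 => x fx0 _; rewrite gee0_abs.
Qed.

Lemma ae_le_integral f g : mu.-integrable setT f -> mu.-integrable setT g ->
  {ae mu, forall x, f x <= g x} -> \int[mu]_x f x <= \int[mu]_x g x.
Proof.
move=> fi gi fg; rewrite -sube_ge0 ?integrable_fin_num//.
rewrite -integralB//; apply: ae_integral_ge0.
  exact: emeasurable_funB (measurable_int _ gi) (measurable_int _ fi).
have := integrable_ae measurableT fi; apply: filterS2 fg => x fgx /(_ Logic.I) fx.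
by rewrite sube_ge0 ?fx.
Qed.

(** Over the set where [f] < 0 the integral is both nonpositive and nonnegative, so |f| integrates
    to 0 there and that set is null. *)
Lemma integral_ge0_ae f : mu.-integrable setT f ->
  (forall A, measurable A -> 0 <= \int[mu]_(x in A) f x) ->
  {ae mu, forall x, 0 <= f x}.
Proof.
move=> fi f0; have mf := measurable_int _ fi.
pose A := setT `&` [set x | f x < 0].
have mA : measurable A by exact: emeasurable_fun_infty_o.
have fiA : mu.-integrable A f by exact: (integrableS measurableT).
have : \int[mu]_(x in A) `|f x| = 0.
  apply/eqP; rewrite eq_le integral_ge0// andbT.
  rewrite (eq_integral (fun x => - f x)); last first.
    by move=> x /[1!inE] -[_ /= fx0]; rewrite lte0_abs.
  by rewrite integralN ?oppe_le0 ?f0// integrable_add_def.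
move/(ae_eq_integral_abs mu mA (measurable_funS measurableT (@subsetT _ A) mf)).1.
apply: filterS => x fA; rewrite leNgt; apply/negP => fx0.
by move: (fx0); rewrite fA ?ltxx//; split.
Qed.

Lemma ae_bounded_integrable (f : T -> R) (C : R) : mu setT < +oo ->
  measurable_fun setT f -> {ae mu, forall x, `|f x| <= C}%R ->
  mu.-integrable setT (fun x => (f x)%:E).
Proof.
move=> muT mf fC; apply/integrableP; split; first exact/measurable_EFinP.
(* [C] may be negative if [mu] is the zero measure, hence its absolute value. *)
apply: (@le_lt_trans _ _ (`|C|%:E * mu setT)).
  apply: integral_le_bound => //; first exact/measurable_EFinP.
  by apply: filterS fC => x fx _; rewrite lee_fin (le_trans fx)// ler_norm.
by rewrite lte_mul_pinfty// lee_fin.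
Qed.

End ae_integral.

(** * Measurability of the pointwise entropies *)

Section measurability.
Context d (T : measurableType d) (R : realType) (M : nat) (p : T -> 'I_M -> R).
Hypothesis mp : forall i, measurable_fun setT (p ^~ i).

Lemma measurable_entropy b : measurable_fun setT (fun y => entropy b (p y)).
Proof.
apply: measurable_funN; apply: measurable_sum => i.
apply: measurable_funM => //; apply: measurable_funM => //.
exact: (measurableT_comp (@measurable_ln R)).
Qed.

Lemma measurable_guess_cost rho s :
  measurable_fun setT (fun y => guess_cost rho (p y) s).
Proof. by apply: measurable_sum => i; exact: measurable_funM. Qed.

Lemma measurable_guessing_entropy rho :
  measurable_fun setT (fun y => guessing_entropy rho (p y)).
Proof.
rewrite /guessing_entropy; elim: (index_enum _) => [|s l IH].
  by under eq_fun do rewrite big_nil; exact: measurable_guess_cost.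
under eq_fun do rewrite big_cons.
by apply: measurable_minr => //; exact: measurable_guess_cost.
Qed.

End measurability.

(** * The conditional pmf and the averaged affine bound *)

Section conditional.
Context {d d'} {Omega : measurableType d} {T : measurableType d'}
  {R : realType} {P : probability Omega R}
  (X : {RV P >-> nat}) (Y : {RV P >-> T}) {M : nat}.
Hypothesis XM : forall w, (1 <= X w <= M)%N.

Let p : T -> 'I_M -> R := @cond_pmf _ _ _ _ _ P X Y M.

(** The events X = 1, ..., X = M partition the sample space by [XM]. *)
Lemma sum_fibers (A : set Omega) : measurable A ->
  (\sum_(i < M) P (X @^-1` [set i.+1] `&` A) = P A)%E.
Proof.
move=> mA; pose F i := X @^-1` [set i.+1] `&` A.
have mF i : measurable (F i) by apply: measurableI => //; exact: measurable_fiber.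
rewrite -(@measure_semi_additive_ord_I _ _ _ P F)//.
- congr (P _); rewrite -bigcup_mkord; apply/seteqP; split=> [w [i _ []]//|w Aw].
  have /andP[Xw0 XwM] := XM w.
  by exists (X w).-1; rewrite /F/= prednK.
- apply/trivIsetP => i j _ _ ij; apply/seteqP; split=> // w [[/= + _] [/= + _]].
  by move=> -> [] /eqP; rewrite (negPf ij).
- exact: bigsetU_measurable.
Qed.

Lemma measurable_cond_pmf i : measurable_fun setT (p ^~ i).
Proof. exact/measurable_EFinP/measurable_int/cond_pmf_integrable. Qed.

(** Radon-Nikodym derivatives are controlled only through integrals: over each measurable B every
    component has a nonnegative integral, and the integrals of the components sum to P(Y in B), as
    for the constant 1. *)
Lemma cond_pmf_ae : {ae distribution P Y, forall y, is_pmf (p y)}.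
Proof.
have ge0 : {ae distribution P Y, forall y i, 0 <= p y i}.
  apply: filter_forall => i.
  suff : {ae distribution P Y, forall y, (0 <= (p y i)%:E)%E}.
    by apply: filterS => y; rewrite lee_fin.
  apply: integral_ge0_ae; first exact: cond_pmf_integrable.
  by move=> A mA; rewrite integral_cond_pmf.
have sum1 : ae_eq (distribution P Y) setT
    (fun y => \sum_(i < M) (p y i)%:E)%E (cst 1%E).
  apply: integral_ae_eq => //.
    by apply: integrable_sum => // i _; exact: cond_pmf_integrable.
  move=> B _ mB; rewrite integral_sum//; last first.
    move=> i; apply: (integrableS measurableT) => //.
    exact: cond_pmf_integrable.
  under eq_bigr do rewrite integral_cond_pmf//.
  rewrite integral_cst// mul1e /distribution/= /pushforward.
  exact/sum_fibers/measurable_rv_preimage.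
apply: filterS2 ge0 sum1 => y y0 y1; split => //.
by apply: EFin_inj; rewrite -sumEFin y1.
Qed.

Section curve.
Context (b rho gamma : R).
Hypotheses (b1 : 1 < b) (M0 : (0 < M)%N) (gamma0 : 0 < gamma).

Lemma integrable_cond_guessing_entropy :
  (distribution P Y).-integrable setT (fun y => (guessing_entropy rho (p y))%:E).
Proof.
apply: (@ae_bounded_integrable _ _ _ _ _ (\sum_(i < M) weight rho i)).
- by rewrite [ltLHS]probability_setT ltry.
- exact/measurable_guessing_entropy/measurable_cond_pmf.
- apply: filterS cond_pmf_ae => y py.
  by rewrite ger0_norm ?guessing_entropy_ge0 ?guessing_entropy_bound.
Qed.

Lemma integrable_cond_entropy :
  (distribution P Y).-integrable setT (fun y => (entropy b (p y))%:E).
Proof.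
(* This constant is log M, the value of the affine bound at parameter 1. *)
apply: (@ae_bounded_integrable _ _ _ _ _ (logb b (@partition R M rho 1))).
- by rewrite [ltLHS]probability_setT ltry.
- exact/measurable_entropy/measurable_cond_pmf.
- apply: filterS cond_pmf_ae => y py.
  rewrite ger0_norm ?entropy_ge0//.
  have := entropy_le_guessing M0 rho b1 ltr01 py.
  by rewrite logb1 mul0r subr0.
Qed.

Lemma cond_entropy_le_guessing :
  (cond_entropy b M X Y <= (logb b (@partition R M rho gamma))%:E -
     (logb b gamma)%:E * cond_guessing_entropy rho M X Y)%E.
Proof.
have gi := integrable_cond_guessing_entropy.
have lgi : (distribution P Y).-integrable setT
    (fun y => (logb b gamma)%:E * (guessing_entropy rho (p y))%:E)%E.
  exact: integrableZl.
have ci := finite_measure_integrable_cst (distribution P Y)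
  (logb b (@partition R M rho gamma)) measurableT.
(* The law of Y has mass 1, so the constant can go under the integral and the bound be compared
   pointwise. *)
have -> : (logb b (@partition R M rho gamma))%:E = (\int[distribution P Y]_y
    (logb b (@partition R M rho gamma))%:E)%E :> \bar R.
  by rewrite integral_cst// [X in (_ * X)%E]probability_setT mule1.
rewrite -integralZl// -integralB//; apply: ae_le_integral.
- exact: integrable_cond_entropy.
- exact: integrableB.
apply: filterS cond_pmf_ae => y py.
by rewrite -EFinM -EFinB lee_fin entropy_le_guessing.
Qed.

End curve.
End conditional.

(** * Continuity of the curve and the range of H *)

Section curve_analysis.
Context {R : realType} {M : nat}.
Hypothesis M0 : (0 < M)%N.
Implicit Types (b rho gamma x : R).

Lemma cvg_powR a x : 0 < x -> y `^ a @[y --> x] --> x `^ a.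
Proof.
move=> x0; apply: (@differentiable_continuous _ _ _ x (@powR R ^~ a)).
by apply/derivable1_diffP; apply: derivable_powR; rewrite in_itv/= x0.
Qed.

Lemma cvg_partition rho gamma : 0 < gamma ->
  @partition R M rho x @[x --> gamma] --> @partition R M rho gamma.
Proof.
move=> g0; apply: cvg_big => [|i _]; first exact: add_continuous.
exact: cvg_powR.
Qed.

Lemma cvg_curve_G rho gamma : 0 < gamma ->
  curve_G rho M x @[x --> gamma] --> curve_G rho M gamma.
Proof.
move=> g0; rewrite (_ : curve_G rho M = fun x =>
    (\sum_(i < M) weight rho i * x `^ weight rho i) / @partition R M rho x);
    last first.
  by apply/funext => x; rewrite /curve_G !big_add1 !big_mkord.
apply: cvgM.
  apply: cvg_big => [|i _]; first exact: add_continuous.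
  by apply: cvgM; [exact: cvg_cst|exact: cvg_powR].
by apply: cvgV; [rewrite gt_eqF// partition_gt0|exact: cvg_partition].
Qed.

Lemma cvg_logb b x : 0 < x -> logb b y @[y --> x] --> logb b x.
Proof. by move=> x0; apply: cvgMl; exact: continuous_ln. Qed.

Lemma cvg_curve_H b rho gamma : 0 < gamma ->
  curve_H b rho M x @[x --> gamma] --> curve_H b rho M gamma.
Proof.
move=> g0; rewrite (_ : curve_H b rho M = fun x =>
    logb b (@partition R M rho x) - logb b x * curve_G rho M x); last first.
  by apply/funext => x; rewrite curve_HE.
apply: cvgB; last by apply: cvgM; [exact: cvg_logb|exact: cvg_curve_G].
apply: (cvg_comp _ _ (cvg_partition g0)).
by apply: cvg_logb; exact: partition_gt0.
Qed.

Lemma xlnx_ge_subr1 x : 0 < x -> x - 1 <= x * ln x.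
Proof.
move=> x0; have : ln (1 + (x^-1 - 1)) <= x^-1 - 1.
  by rewrite le_ln1Dx// ltrBrDl subrr invr_gt0.
rewrite addrC subrK lnV ?posrE// -(ler_pM2l x0) mulrBr divff ?gt_eqF//.
by rewrite mulr1 mulrN lerNl opprB.
Qed.

(** With r the square root of [x], multiply ln (1/r) <= 1/r by r^2 and use ln x = 2 ln r. *)
Lemma xlnx_ge_sqrt x : 0 < x -> - 2 * x `^ 2^-1 <= x * ln x.
Proof.
move=> x0; set r := x `^ 2^-1; have r0 : 0 < r by exact: powR_gt0.
have xr : x = r * r.
  have E : 2^-1 + 2^-1 = 1 :> R by field.
  by rewrite -powRD E ?powRr1 ?ltW// gt_eqF// implybT.
have rV : ln r^-1 <= r^-1 by rewrite ltW// ln_sublinear ?invr_gt0.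
have : r * r * ln r^-1 <= r.
  by rewrite -[leRHS]mulr1 -(divff (lt0r_neq0 r0)) mulrA ler_pM2l ?mulr_gt0.
rewrite lnV ?posrE// [in X in _ -> X]xr lnM ?posrE//; lra.
Qed.

End curve_analysis.

(** The partition sum is at least its first term, which is [gamma] itself because the first weight
    is 1. *)
Lemma curve_pmf_le {R : realType} m (rho gamma : R) (i : 'I_m.+1) : 0 < gamma ->
  curve_pmf rho gamma i <= gamma `^ (weight rho i - 1).
Proof.
move=> g0; rewrite powRB ?(lt0r_neq0 g0) ?implybT// powRr1 ?(ltW g0)//.
rewrite /curve_pmf ler_pM2l ?powR_gt0// lef_pV2 ?posrE ?partition_gt0//.
have w1 : weight rho (@ord0 m) = 1 :> R by rewrite /weight powR1.
rewrite /partition big_ord_recl w1 powRr1 ?(ltW g0)// lerDl.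
by apply: sumr_ge0 => j _; exact: powR_ge0.
Qed.

(* H(gamma) is the entropy of curve_pmf: its atom at 1 contributes at most one
   minus its mass, and each other atom of mass q at most 2 sqrt q. *)
Lemma curve_H_le {R : realType} m (b rho gamma : R) : 1 < b -> 0 < gamma ->
  curve_H b rho m.+1 gamma * ln b <=
  3 * \sum_(i < m) gamma `^ ((weight rho (lift ord0 i) - 1) * 2^-1).
Proof.
move=> b1 g0; rewrite -(entropy_curve_pmf (ltn0Sn m) b rho g0).
set p := curve_pmf rho gamma.
have p0 i : 0 < p i by exact: curve_pmf_gt0.
have [_ p1] := curve_pmf_pmf (ltn0Sn m) rho g0.
have -> : entropy b p * ln b = - \sum_(i < m.+1) p i * ln (p i).
  rewrite /entropy mulNr mulr_suml; congr (- _); apply: eq_bigr => i _.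
  by rewrite /logb mulrA divfK// gt_eqF// ln_gt0.
rewrite big_ord_recl opprD mulr_sumr.
(* The 1 pays for each atom's share of the missing mass of the first atom, the 2 for its own entropy
   term. *)
have -> : 3 = 1 + 2 :> R by ring.
have E := xlnx_ge_subr1 (p0 ord0).
have {}E : - (p ord0 * ln (p ord0)) <= \sum_(i < m) p (lift ord0 i).
  by move: p1; rewrite -/p big_ord_recl; lra.
apply: (le_trans (lerD E (lexx _))).
rewrite -sumrN -big_split/=; apply: ler_sum => i _; set q := p (lift ord0 i).
have qr : q `^ 2^-1 <= gamma `^ ((weight rho (lift ord0 i) - 1) * 2^-1).
  by rewrite powRrM ge0_ler_powR ?invr_ge0 ?nnegrE ?powR_ge0 ?curve_pmf_le// ltW ?p0.
have q1 : q <= 1 by exact: (is_pmf_le1 _ (curve_pmf_pmf (ltn0Sn m) rho g0)).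
have q0 : 0 < q by exact: p0.
(* Since q <= 1, the missing mass is also controlled by square roots. *)
have qs : q <= q `^ 2^-1.
  by rewrite ger1_powR ?q0//; lra.
have := xlnx_ge_sqrt q0; move: qr qs.
move: (q * ln q) (q `^ 2^-1) (gamma `^ _) => u v w; clear; lra.
Qed.

(** The majorant of [curve_H_le] tends to 0 at 0+: it has finitely many terms, and their exponents
    are positive because weights beyond the first exceed 1 when [rho] > 0. *)
Lemma curve_H_arbitrarily_small {R : realType} m (b rho h : R) :
    1 < b -> 0 < rho -> 0 < h ->
  exists2 gamma, 0 < gamma <= 1 & curve_H b rho m.+1 gamma <= h.
Proof.
move=> b1 rho0 h0; have lnb : 0 < ln b by rewrite ln_gt0.
have lim0 : 3 * \sum_(i < m) x `^ ((weight rho (lift ord0 i) - 1) * 2^-1)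
    @[x --> (0 : R)^'+] --> (3 * \sum_(i < m) 0 : R).
  apply: cvgM; first exact: cvg_cst.
  apply: cvg_big => [|i _]; first exact: add_continuous.
  apply: powR_cvg0; rewrite mulr_gt0 ?invr_gt0// subr_gt0.
  have {1}<- : 1 `^ rho = 1 :> R by rewrite powR1.
  by rewrite /weight gt0_ltr_powR// ?nnegrE ?ltr1n.
rewrite big1// mulr0 in lim0.
have : \forall x \near (0 : R)^'+,
    3 * \sum_(i < m) x `^ ((weight rho (lift ord0 i) - 1) * 2^-1) < h * ln b.
  by apply: (cvgr_lt _ lim0); rewrite mulr_gt0.
move=> small; near (0 : R)^'+ => gamma.
have gamma0 : 0 < gamma by near: gamma; exact: nbhs_right_gt.
exists gamma; first by rewrite gamma0/=; near: gamma; exact: nbhs_right_le.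
rewrite -(ler_pM2r lnb) (le_trans (curve_H_le _ _ _ _))// ltW//.
by near: gamma.
Unshelve. all: by end_near. Qed.

Lemma curve_H_surjective {R : realType} m (b rho h : R) :
    1 < b -> 0 < rho -> 0 < h <= logb b m.+1%:R ->
  exists2 gamma, 0 < gamma <= 1 & curve_H b rho m.+1 gamma = h.
Proof.
move=> b1 rho0 /andP[h0 hM].
(* Continuity is available only at positive parameters, so the interval starts at some [g] > 0
   rather than at 0. *)
have [g /andP[g0 g1] gh] := curve_H_arbitrarily_small m b1 rho0 h0.
have cH : {within `[g, 1], continuous (curve_H b rho m.+1)}.
  apply: continuous_in_subspaceT => x; rewrite inE/= in_itv/= => /andP[gx _].
  by apply: cvg_curve_H => //; exact: lt_le_trans gx.
have [|c] := IVT g1 cH (v := h).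
  by rewrite ge_min le_max gh curve_H1 hM orbT.
rewrite in_itv/= => /andP[gc c1] cE; exists c => //.
by rewrite c1 (lt_le_trans g0).
Qed.

(** * The lower bound on the conditional guessing entropy *)

Section lower_bound.
Context {d d'} {Omega : measurableType d} {T : measurableType d'}
  {R : realType} {P : probability Omega R}
  (X : {RV P >-> nat}) (Y : {RV P >-> T}) {M : nat} (b rho : R).
Hypothesis XM : forall w, (1 <= X w <= M)%N.
Hypotheses (b1 : 1 < b) (M0 : (0 < M)%N).

(** The affine bound is solved for the guessing entropy by dividing by - log [gamma] > 0. Assuming
    only an inequality on the entropy lets one pair (X, Y) serve many [gamma] at once, as the limit
    at 1 requires. *)
Lemma curve_lower_bound_lt1 gamma : 0 < gamma < 1 ->
  ((curve_H b rho M gamma)%:E <= cond_entropy b M X Y)%E ->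
  ((curve_G rho M gamma)%:E <= cond_guessing_entropy rho M X Y)%E.
Proof.
move=> g01; have /andP[g0 g1] := g01.
move=> /le_trans/(_ (cond_entropy_le_guessing Y XM rho b1 M0 g0)).
(* Finiteness of the integral is what permits cancellation in the extended reals. *)
have := integrable_fin_num measurableT
  (integrable_cond_guessing_entropy Y XM rho).
rewrite /cond_guessing_entropy; set G := (\int[_]_y _)%E => /fineK <-.
rewrite -EFinM -EFinB !lee_fin curve_HE lerD2l lerN2 ler_nM2l//.
exact: logb_lt0.
Qed.

(* At gamma = 1 the slope of the affine bound vanishes; since H(1) = log M is
   the largest entropy, the bounds for all gamma < 1 are available instead. *)
Lemma curve_lower_bound gamma : 0 < gamma <= 1 ->
  cond_entropy b M X Y = (curve_H b rho M gamma)%:E ->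
  ((curve_G rho M gamma)%:E <= cond_guessing_entropy rho M X Y)%E.
Proof.
move=> /andP[g0]; rewrite le_eqVlt => /predU1P[->|g1] HE; last first.
  by apply: curve_lower_bound_lt1; rewrite ?g0 ?HE.
have := integrable_fin_num measurableT
  (integrable_cond_guessing_entropy Y XM rho).
rewrite -/(cond_guessing_entropy rho M X Y) => /fineK Gfin.
rewrite -Gfin lee_fin.
have cG : curve_G rho M x @[x --> (1:R)^'-] --> curve_G rho M 1.
  by apply: cvg_at_left_filter; exact: cvg_curve_G.
apply: (cvgr_to_le cG); near=> x; rewrite -lee_fin Gfin.
have x0 : 0 < x by near: x; exact: nbhs_left_gt.
apply: curve_lower_bound_lt1; first by rewrite x0; near: x; exact: nbhs_left_lt.
by rewrite HE lee_fin curve_H_le_entropy1.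
Unshelve. all: by end_near. Qed.

End lower_bound.

(** * Realization of a pmf with constant side information *)

Lemma mnormalize_id d (T : measurableType d) (R : realType)
    (mu : {measure set T -> \bar R}) (P : probability T R) (A : set T) :
  mu setT = 1%E -> mnormalize mu P A = mu A.
Proof. by move=> mu1; rewrite /mnormalize mu1 onee_eq0/= invr1 mule1. Qed.

Section attainment.
Context {R : realType} (m : nat) (f : nat -> {nonneg R}).
Hypothesis f1 : \sum_(i < m.+1) (f i)%:num = 1.

(** Normalization supplies the probability structure and changes nothing, as the total mass is
    already 1; the Dirac mass is only its fallback value. *)
Definition discrete_law : probability nat R :=
  mnormalize (msum (fun i => mscale (f i) \d_i) m.+1) \d_0%N.

Lemma discrete_lawE (A : set nat) :
  (discrete_law A = \sum_(i < m.+1) (f i)%:num%:E * \d_(i : nat) A)%E.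
Proof.
have S1 : msum (fun i => mscale (f i) \d_i) m.+1 setT = 1%:E :> \bar R.
  rewrite /msum -f1 -sumEFin; apply: eq_bigr => i _.
  transitivity ((f i)%:num%:E * \d_(i : nat) [set: nat])%E => //.
  by rewrite diracT mule1.
exact: mnormalize_id S1.
Qed.

(** The range condition on X is imposed at every sample point, not almost surely, so the shifted
    identity is capped outside the support. *)
Definition clamp (w : nat) : nat := (minn w m).+1.

Lemma measurable_clamp : measurable_fun setT clamp.
Proof. by []. Qed.

HB.instance Definition _ := isMeasurableFun.Build _ _ _ _ clamp measurable_clamp.

Let X : {RV discrete_law >-> nat} := clamp.
Let Y : {RV discrete_law >-> unit} := cst tt.

Lemma clamp_range w : (1 <= X w <= m.+1)%N.
Proof. by rewrite /X/= /clamp ltnS geq_minr. Qed.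

Lemma integral_unit (mu : probability unit R) (g : unit -> R) :
  (\int[mu]_y (g y)%:E = (g tt)%:E)%E.
Proof.
rewrite (eq_integral (cst (g tt)%:E)); last by case.
by rewrite integral_cst// [X in (_ * X)%E]probability_setT mule1.
Qed.

(** On a one-point space a function equals its integral against a probability, so the derivative is
    determined exactly, as P(X = i + 1). *)
Lemma cond_pmf_clamp : @cond_pmf _ _ _ _ _ discrete_law X Y m.+1 tt =
  fun i => (f i)%:num.
Proof.
apply/funext => i; apply: EFin_inj.
rewrite -(integral_unit (distribution discrete_law Y) (fun y => cond_pmf X Y y i)).
rewrite integral_cond_pmf// preimage_setT setIT discrete_lawE (bigD1 i)//= big1.
  rewrite adde0 diracE mem_set ?mule1//= /X/= /clamp.
  by rewrite (minn_idPl _)// -ltnS.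
move=> j ji; rewrite diracE memNset ?mule0//= /X/= /clamp.
rewrite (minn_idPl (ltn_ord j : (j <= m)%N)) => -[] /val_inj ij.
by rewrite ij eqxx in ji.
Qed.

Lemma attainment (b rho : R) : exists (d d' : measure_display)
    (Omega : measurableType d) (T : measurableType d')
    (P : probability Omega R) (X : {RV P >-> nat}) (Y : {RV P >-> T}),
  [/\ forall w : Omega, (1 <= X w <= m.+1)%N,
      cond_entropy b m.+1 X Y = (entropy b (fun i : 'I_m.+1 => (f i)%:num))%:E &
      cond_guessing_entropy rho m.+1 X Y =
        (guessing_entropy rho (fun i : 'I_m.+1 => (f i)%:num))%:E].
Proof.
exists _, _, nat, unit, discrete_law, X, Y; split; first exact: clamp_range.
  rewrite /cond_entropy (integral_unit (distribution discrete_law Y)).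
  by rewrite cond_pmf_clamp.
rewrite /cond_guessing_entropy (integral_unit (distribution discrete_law Y)).
by rewrite cond_pmf_clamp.
Qed.

End attainment.

Theorem theorem2 (R : realType) (b : R) (M : nat) (rho : R)
    (hb : 1 < b) (hM : (2 <= M)%N) (hrho : 0 < rho) :
  (forall (d d' : measure_display)
      (Omega : measurableType d) (T : measurableType d')
      (P : probability Omega R) (X : {RV P >-> nat}) (Y : {RV P >-> T})
      (gamma : R),
    (forall w : Omega, (1 <= X w <= M)%N) ->
    0 < gamma <= 1 ->
    cond_entropy b M X Y = (curve_H b rho M gamma)%:E ->
    ((curve_G rho M gamma)%:E <= cond_guessing_entropy rho M X Y)%E)
  /\
  (forall gamma : R, 0 < gamma <= 1 ->
    exists (d d' : measure_display)
      (Omega : measurableType d) (T : measurableType d')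
      (P : probability Omega R) (X : {RV P >-> nat}) (Y : {RV P >-> T}),
      [/\ forall w : Omega, (1 <= X w <= M)%N,
          cond_entropy b M X Y = (curve_H b rho M gamma)%:E &
          cond_guessing_entropy rho M X Y = (curve_G rho M gamma)%:E])
  /\
  (forall h : R, 0 < h <= logb b M%:R ->
    exists2 gamma : R, 0 < gamma <= 1 & curve_H b rho M gamma = h).
Proof.
have M0 : (0 < M)%N by exact: ltnW.
split=> [d d' Omega T P X Y gamma XM g01|]; first exact: curve_lower_bound.
case: M M0 hM => // m M0 _; split=> [gamma g01|h]; last exact: curve_H_surjective.
have /andP[g0 _] := g01.
have f0 i : 0 <= gamma `^ weight rho i / @partition R m.+1 rho gamma.
  by rewrite divr_ge0 ?powR_ge0// ltW// partition_gt0.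
(* Both coordinates of the curve are entropies of [curve_pmf], which becomes the law of X. *)
rewrite -(entropy_curve_pmf M0 b rho g0) -(guessing_curve_pmf M0 rho g01).
exact: (attainment (f := fun i => NngNum (f0 i)) (curve_pmf_pmf M0 rho g0).2).
Qed.
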